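(* Let $e\ge2$ be an integer. Let $a_1,b_1\in\mathbb{N}$ be such that $a_1\le q-2$ and $0\le b_1-ea_1\le q-1$, and let $a_2,b_2\in\mathbb{N}$ be such that $a_1\le q-a_2-3$ and $0\le b_2-ea_2\le q-1$. For $i\in\{1,2\}$ set $$\widetilde{s}_i:=\max\left\{-1,\left\lfloor\frac{b_i-q}{e}\right\rfloor\right\}.$$ Then there exists a $[[(q+1)^2,\,(q+1)^2-k_2-k_1,\,d]]_q$ quantum code, where for $i\in\{1,2\}$ $$k_i=(\widetilde{s}_i+1)(q+1)+(a_i-\widetilde{s}_i)\left(b_i+1-e\left(\frac{a_i+\widetilde{s}_i+1}{2}\right)\right)$$ and $$d\ge\min\{a_1,\,a_2,\,b_1-ea_1,\,b_2-ea_2\}+2 .$$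
   Context: $q$ is a prime power and $\mathbb{F}_q$ the field with $q$ elements; $\mathbb{N}=\{0,1,2,\dots\}$. For $E\subset\mathbb{F}_q^n\setminus\{0\}$, $d(E)$ denotes the minimal Hamming weight of an element of $E$, and duals are taken with respect to the standard (Euclidean) bilinear form. The quantum codes considered are CSS codes: a pair of linear codes $C_1\subset C_2\subset\mathbb{F}_q^n$ gives an $[[n,k,d]]_q$ quantum code $(C_1,C_2)_{\mathrm{CSS}}$ with $k=\dim C_2-\dim C_1$ and $d=\min\{d(C_2\setminus C_1),\,d(C_1^\perp\setminus C_2^\perp)\}$. *)

(* Defs.v *)
From HB Require Import structures.
From mathcomp Require Import all_boot all_order all_algebra.

Set Implicit Arguments.
Unset Strict Implicit.
Unset Printing Implicit Defensive.

Import Order.TTheory GRing.Theory Num.Theory.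
Local Open Scope ring_scope.

Definition hamming_weight (F : finFieldType) (n : nat) (v : 'rV[F]_n) : nat :=
  #|[set i | v 0 i != 0]|.

Definition vectors (F : finFieldType) (n : nat) (C : {vspace 'rV[F]_n}) :
    {set 'rV[F]_n} :=
  [set v : 'rV[F]_n | v \in C].

Definition dual_code (F : finFieldType) (n : nat) (C : {vspace 'rV[F]_n}) :
    {set 'rV[F]_n} :=
  [set v : 'rV[F]_n | [forall u : 'rV[F]_n in C, \sum_(i < n) u 0 i * v 0 i == 0]].

(* d(E) is a relation rather than a function: it has no value when E is
   empty. *)
Definition is_min_weight (F : finFieldType) (n : nat) (E : {set 'rV[F]_n})
    (d : nat) : Prop :=
  (exists2 v, v \in E & hamming_weight v = d) /\
  (forall v, v \in E -> (d <= hamming_weight v)%N).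

(* (C1, C2)_CSS is an [[n, k, d]]_q quantum code, with q = #|F|.  As
   is_min_weight has no value on the empty set, this forces C1 != C2, that is
   k > 0. *)
Definition is_CSS_code (F : finFieldType) (n : nat) (C1 C2 : {vspace 'rV[F]_n})
    (k d : nat) : Prop :=
  [/\ (C1 <= C2)%VS,
      k = (\dim C2 - \dim C1)%N &
      exists d1 d2 : nat,
        [/\ is_min_weight (vectors C2 :\: vectors C1) d1,
            is_min_weight (dual_code C1 :\: dual_code C2) d2 &
            d = minn d1 d2]].

Definition s_tilde (q e b : nat) : int :=
  Num.max (-1) (Num.floor ((b%:R - q%:R) / e%:R : rat)).

(* Rational-valued because (a + s_tilde + 1) / 2 need not be an integer. *)
Definition k_dim (q e a b : nat) : rat :=
  let s : rat := (s_tilde q e b)%:~R in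
  (s + 1) * (q%:R + 1) +
  (a%:R - s) * (b%:R + 1 - e%:R * ((a%:R + s + 1) / 2)).

(* Main.v *)
(* Let m = q - 1 - a1 - a2 >= 2 and let h be a form of degree m without zeros on
   P^1(F_q).  With PRS_a the projective Reed-Solomon code of degree a, the
   length q + 1 codes V1 = PRS_a1 and V2 = h * PRS_a2 are orthogonal, so for
   W_i = PRS_(b_i - e a_i) the products U_i = V_i (x) W_i, of dimension at most
   k_i, are orthogonal in F_q^((q+1)^2).  Any flag U1 <= C1 <= C2 <= U2^perp with
   dim C1 = k1 and dim C2 = n - k2 gives the quantum code: both C2 and C1^perp
   lie in duals U_i^perp, and a nonzero word orthogonal to V_i (x) W_i has weight
   at least min(a_i, b_i - e a_i) + 2, since otherwise a product of forms
   isolates one point of its support.  The number k_i is the sum over j <= a_i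
   of min(b_i - e j + 1, q + 1), the dimension of the code on the Hirzebruch
   surface. *)
Require Import Defs.
From HB Require Import structures.
From mathcomp Require Import all_boot all_order all_algebra all_field.
From mathcomp Require Import zify ring.

Set Implicit Arguments.
Unset Strict Implicit.
Unset Printing Implicit Defensive.

Import Order.TTheory GRing.Theory Num.Theory.
Local Open Scope ring_scope.

(** * Sums over [option] and intermediate subspaces *)

Lemma big_option (R : nmodType) (T : finType) (f : option T -> R) :
  \sum_x f x = f None + \sum_t f (Some t).
Proof.
rewrite (bigD1 None) //=; congr (_ + _).
rewrite (reindex_omap Some id) /=; last by case.
by apply: eq_bigl => t; rewrite eqxx.
Qed.

(** Starting from [U], vectors of [W] outside the current space are adjoined one at a time, each
    raising the dimension by one. *)
Lemma exists_subspace_dim (K : fieldType) (vT : vectType K)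
    (U W : {vspace vT}) k :
  (U <= W)%VS -> (\dim U <= k <= \dim W)%N ->
  exists X : {vspace vT}, [/\ (U <= X)%VS, (X <= W)%VS & \dim X = k].
Proof.
move=> sUW /andP[].
elim: k => [|k IHk] leUk lekW.
  by exists U; split=> //; apply/eqP; rewrite -leqn0.
move: leUk; rewrite leq_eqVlt => /predU1P[dU|]; first by exists U.
rewrite ltnS => /IHk /(_ (ltnW lekW)) [X [sUX sXW dX]].
have [x xW xX] : exists2 x, x \in W & x \notin X.
  apply/subvPn/negP => /dimvS; lia.
exists (X + <[x]>)%VS; split.
- exact: subv_trans sUX (addvSl _ _).
- by rewrite subv_add sXW -memvE.
rewrite dimv_disjoint_sum ?dX ?dim_vline; last first.
  apply/eqP; rewrite -subv0; apply/subvP => y /memv_capP[yX /vlineP[c yc]].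
  rewrite memv0 yc; have [->|c0] := eqVneq c 0; first by rewrite scale0r.
  by case/negP: xX; rewrite -(scalerK c0 x) -yc memvZ.
suff -> : x != 0 by rewrite addn1.
by apply: contraNneq xX => ->; rewrite mem0v.
Qed.

(** * Separating families and weights of words orthogonal to a product *)

Section Separation.
Variable F : fieldType.

(** Equivalently, any at most [k + 1] columns of the generator matrix given by [f] are independent,
    so nonzero dual words have weight at least [k + 2]. *)
Definition separates (P : finType) m (f : 'I_m -> P -> F) (k : nat) :=
  forall (S : {set P}) x0, x0 \notin S -> (#|S| <= k)%N ->
  exists c : 'I_m -> F, \sum_j c j * f j x0 != 0 /\
    {in S, forall x, \sum_j c j * f j x = 0}.

Lemma separates_scale (P : finType) m (f : 'I_m -> P -> F) k (h : P -> F) :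
  (forall x, h x != 0) -> separates f k -> separates (fun j x => h x * f j x) k.
Proof.
have hE x c : \sum_j c j * (h x * f j x) = h x * \sum_j c j * f j x.
  by rewrite mulr_sumr; apply: eq_bigr => j _; rewrite mulrCA.
move=> h0 sep S x0 x0S cS; have [c [cx0 cS0]] := sep S x0 x0S cS.
exists c; split=> [|x xS]; first by rewrite hE mulf_neq0.
by rewrite hE cS0 ?mulr0.
Qed.

Lemma tensor_orth_weight (P Q : finType) m n (f : 'I_m -> P -> F)
    (g : 'I_n -> Q -> F) a b (X : P * Q -> F) :
  separates f a -> separates g b ->
  (forall j l, \sum_z f j z.1 * g l z.2 * X z = 0) ->
  (exists z, X z != 0%R) -> (minn a b + 2 <= #|[set z | X z != 0%R]|)%N.
Proof.
move=> sepf sepg orth [[x0 y0] Xz]; rewrite leqNgt; apply/negP => small.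
set S := [set z | X z != 0] in small.
have zS : (x0, y0) \in S by rewrite inE.
(* Once the projection of the chosen support point is removed, at most [minn a b] values remain, few
   enough for both families. *)
have proj_small (T : finType) (p : P * Q -> T) k : (minn a b <= k)%N ->
    (#|(p @: S) :\ p (x0, y0)| <= k)%N.
  have := leq_imset_card p S; rewrite (cardsD1 (p (x0, y0)) (p @: S)).
  by rewrite imset_f //; lia.
have [c [cx cS]] := sepf _ _ (negbT (setD11 _ _)) (proj_small _ fst a (geq_minl _ _)).
have [d [dy dS]] := sepg _ _ (negbT (setD11 _ _)) (proj_small _ snd b (geq_minr _ _)).
have /eqP := mulf_neq0 (mulf_neq0 cx dy) Xz; apply.
(* The product of the two combinations vanishes on the support of [X] except at [(x0, y0)];
   expanded, the same sum is zero by [orth]. *)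
transitivity (\sum_z (\sum_j c j * f j z.1) * (\sum_l d l * g l z.2) * X z).
  rewrite (bigD1 (x0, y0)) //= [Y in _ + Y]big1 ?addr0 // => -[x y] /= zne.
  have [Xz0|Xz0] := eqVneq (X (x, y)) 0; first by rewrite Xz0 mulr0.
  have xyS : (x, y) \in S by rewrite inE.
  have [xx|xx] := eqVneq x x0; last first.
    by rewrite cS ?mul0r // 2!inE xx; apply/imsetP; exists (x, y).
  rewrite dS ?mulr0 ?mul0r // 2!inE.
  have yy : y != y0 by move: zne; rewrite xpair_eqE xx eqxx.
  by rewrite yy; apply/imsetP; exists (x, y).
under eq_bigr => z _ do rewrite big_distrlr /= mulr_suml.
rewrite exchange_big big1 // => j _ /=.
under eq_bigr => z _ do rewrite mulr_suml.
rewrite exchange_big big1 // => l _ /=.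
transitivity (c j * d l * \sum_z f j z.1 * g l z.2 * X z).
  by rewrite mulr_sumr; apply: eq_bigr => z _; rewrite mulrACA !mulrA.
by rewrite orth mulr0.
Qed.

End Separation.

(** * Projective Reed-Solomon codes and power sums over a finite field *)

Section ProjectiveReedSolomon.
Variable F : finFieldType.

(* A form of degree [a] on the projective line, dehomogenised to a polynomial
   of size at most [a.+1]; its value at the point at infinity [None] is its
   coefficient of degree [a]. *)
Definition proj_eval (a : nat) (p : {poly F}) (x : option F) : F :=
  if x is Some t then p.[t] else p`_a.

Definition proj_mono (a : nat) (j : 'I_a.+1) : option F -> F :=
  proj_eval a 'X^j.

Lemma proj_eval_mono a (p : {poly F}) x : (size p <= a.+1)%N ->
  \sum_(j < a.+1) p`_j * proj_mono j x = proj_eval a p x.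
Proof.
move=> sp; case: x => [t|] /=.
  by rewrite (horner_coef_wide _ sp); apply: eq_bigr => j _; rewrite /proj_mono /= hornerXn.
rewrite big_ord_recr /= big1 ?add0r; last first.
  by move=> j _; rewrite /proj_mono /= coefXn gtn_eqF ?mulr0 /=.
by rewrite /proj_mono /= coefXn eqxx mulr1.
Qed.

(** A product of linear forms, one for each point of [S], has degree at most [a] and does not vanish
    at [x0]. *)
Lemma separates_proj_mono a : separates (@proj_mono a) a.
Proof.
move=> S x0 x0S cS.
set s := pmap id (enum (S :\ None)).
set p0 : {poly F} := \prod_(y <- s) ('X - y%:P).
have sE y : (y \in s) = (Some y \in S).
  by rewrite mem_pmap map_id mem_enum in_setD1.
have size_s : (size s + (None \in S) <= a)%N.
  rewrite size_pmap addnC (leq_trans _ cS) // (cardsD1 None S) leq_add2l.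
  by rewrite cardE count_size.
have size_p0 : size p0 = (size s).+1 by rewrite size_prod_XsubC.
have p0_root t : (p0.[t] == 0) = (Some t \in S).
  by rewrite -/(root p0 t) root_prod_XsubC sE.
case: x0 x0S => [t0|] x0S.
  have size_p : (size p0 <= a.+1)%N by rewrite size_p0; lia.
  exists (fun j : 'I_a.+1 => p0`_j); split.
    by rewrite proj_eval_mono //= p0_root.
  move=> [t|] xS; rewrite proj_eval_mono //=; first by apply/eqP; rewrite p0_root.
  (* With infinity in [S], fewer than [a] finite points remain, so the coefficient of degree [a] is
     zero. *)
  by rewrite nth_default // size_p0; move: size_s; rewrite xS; lia.
(* Here [x0] is infinity: padding to degree exactly [a] makes the value there the leading
   coefficient 1, and extra zeros at [0] do no harm. *)
set p := p0 * 'X^(a - size s).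
have p_monic : p \is monic by rewrite monicMr ?monicXn // monic_prod_XsubC.
have size_p : size p = a.+1.
  rewrite size_Mmonic ?monicXn ?monic_neq0 ?monic_prod_XsubC //.
  rewrite size_p0 size_polyXn; lia.
exists (fun j : 'I_a.+1 => p`_j); split.
  rewrite proj_eval_mono ?size_p //=.
  by move/monicP: p_monic; rewrite lead_coefE size_p /= => ->; rewrite oner_neq0.
move=> [t|] xS; last by rewrite xS in x0S.
rewrite proj_eval_mono ?size_p //= hornerM.
by move: (p0_root t); rewrite xS => /eqP ->; rewrite mul0r.
Qed.

Lemma sum_expr_lt i : (i < #|F|.-1)%N -> \sum_(t : F) t ^+ i = 0.
Proof.
move=> hi; case: i hi => [_|i hi].
  (* Exponent 0: translation by 1 permutes the field, which forces the sum of ones to vanish. *)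
  have : \sum_(t : F) t = \sum_(t : F) (t + 1).
    by rewrite (reindex_inj (addIr 1)).
  rewrite big_split /= => /eqP; rewrite -subr_eq0 opprD addrA subrr add0r oppr_eq0.
  by move/eqP => sum1; under eq_bigr => t _ do rewrite expr0.
(* A non-root [g] of [p] exists since the degree is below [#|F|]; it is nonzero with
   [g ^+ i.+1 != 1], so substituting [g * t] scales the sum by a factor other than 1. *)
pose p : {poly F} := 'X^(i.+2) - 'X.
have size_p : size p = i.+3.
  by rewrite size_polyDl ?size_polyN ?size_polyX ?size_polyXn.
have [g gp] : exists g, ~~ root p g.
  apply/existsP; rewrite -negb_forall; apply/negP => /forallP rp.
  have := @max_poly_roots _ p (enum F).
  rewrite -size_poly_gt0 size_p -cardE => /(_ isT) H.
  suff : (#|F| < i.+3)%N by lia.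
  by apply: H; [apply/allP => x _; exact: rp | exact: enum_uniq].
have g0 : g != 0.
  by apply: contraNneq gp => ->; rewrite rootE !hornerE expr0n subrr.
have gi : g ^+ i.+1 != 1.
  apply: contraNneq gp => gi; rewrite rootE !hornerE exprS gi mulr1.
  by rewrite subrr.
have /eqP : \sum_(t : F) t ^+ i.+1 = g ^+ i.+1 * \sum_(t : F) t ^+ i.+1.
  rewrite {1}(reindex_inj (mulfI g0)) mulr_sumr.
  by apply: eq_bigr => t _; rewrite exprMn.
rewrite -subr_eq0 -{1}[X in X - _]mul1r -mulrBl mulf_eq0 subr_eq0 eq_sym.
by rewrite (negPf gi) => /eqP.
Qed.

Lemma sum_expr_pred : \sum_(t : F) t ^+ #|F|.-1 = -1.
Proof.
have F2 : (1 < #|F|)%N by exact: finNzRing_gt1.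
rewrite (bigD1 0) //= expr0n; have -> : (#|F|.-1 == 0%N) = false by lia.
rewrite add0r (eq_bigr (fun=> 1)); last first.
  move=> t t0; apply: (mulfI t0); rewrite -exprS prednK ?expf_card ?mulr1 //.
  by rewrite ltnW.
(* Dropping the term at [0] from this vanishing sum shows that the ones over nonzero [t] add up to
   -1. *)
have /eqP : \sum_(t : F) t ^+ 0 = 0 by apply: sum_expr_lt; lia.
rewrite (bigD1 0) //= expr0 addrC addr_eq0 => /eqP <-.
by apply: eq_bigr => t _; rewrite expr0.
Qed.

Lemma sum_horner (p : {poly F}) : (size p <= #|F|)%N ->
  \sum_t p.[t] = - p`_(#|F|.-1).
Proof.
have F2 : (1 < #|F|)%N by exact: finNzRing_gt1.
have: #|F| = #|F|.-1.+1 by lia.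
move: (#|F|.-1) (@sum_expr_lt) sum_expr_pred => n slt sp -> size_p.
under eq_bigr => t _ do rewrite (horner_coef_wide _ size_p).
rewrite exchange_big big_ord_recr /= -mulr_sumr sp mulrN1 big1 ?add0r // => i _.
by rewrite -mulr_sumr slt ?mulr0.
Qed.

(* [t ^+ m + t ^+ m.-1] takes the value 0 at both [0] and [-1], so it is not
   injective on the finite field, hence misses some [c]; subtract that [c]. *)
Lemma exists_monic_rootless m : (2 <= m)%N ->
  exists h : {poly F}, [/\ h \is monic, size h = m.+1 & forall t, h.[t] != 0].
Proof.
case: m => [|[|m]] // _.
pose f (t : F) := t ^+ m.+1 * (t + 1).
have [c cf] : exists c, c \notin codom f.
  apply/existsP; rewrite -negb_forall; apply/negP => /forallP surj.
  have /image_injP inj : #|image f F| == #|F|.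
    by apply/eqP; apply: eq_card => y; rewrite (surj y) inE.
  have := inj 0 (-1) isT isT; rewrite /f expr0n mul0r addNr mulr0.
  by move=> /(_ erefl)/eqP; rewrite eq_sym oppr_eq0 oner_eq0.
pose h : {poly F} := 'X^(m.+1) * ('X + 1%:P) - c%:P.
have size_g : size ('X^(m.+1) * ('X + 1%:P) : {poly F}) = m.+3.
  by rewrite size_Mmonic ?monicXaddC // ?monic_neq0 ?monicXn // size_polyXn size_XaddC addn2.
have lt : (size (- c%:P : {poly F})%R < size ('X^(m.+1) * ('X + 1%:P) : {poly F})%R)%N.
  by rewrite size_g size_polyN (leq_ltn_trans (size_polyC_leq1 _)).
exists h; split.
- by rewrite monicE lead_coefDl // -monicE monicMl ?monicXn ?monicXaddC.
- by rewrite size_polyDl.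
move=> t; rewrite !hornerE subr_eq0; apply: contraNneq cf => <-.
by apply: codom_f.
Qed.

(** The product is a form of degree [#|F|.-1]: its coefficient of that degree is its value at
    infinity, and by [sum_horner] the affine points contribute minus that coefficient. *)
Lemma proj_mono_orth a1 a2 m (h : {poly F}) (i : 'I_a1.+1) (j : 'I_a2.+1) :
  h \is monic -> size h = m.+1 -> (a1 + a2 + m)%N = #|F|.-1 ->
  \sum_x proj_mono i x * (proj_eval m h x * proj_mono j x) = 0.
Proof.
move=> h_monic size_h sum_deg.
have F2 : (1 < #|F|)%N by exact: finNzRing_gt1.
have hm : h`_m = 1 by move/monicP: h_monic; rewrite lead_coefE size_h.
have ia := ltn_ord i; have ja := ltn_ord j.
rewrite big_option.
under [X in _ + X]eq_bigr => t _ do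
  rewrite /proj_mono /= mulrCA -!hornerM -exprD.
rewrite sum_horner; last first.
  rewrite (leq_trans (size_polyMleq _ _)) // size_h size_polyXn; lia.
rewrite /proj_mono /= !coefXn hm mul1r coefMXn -sum_deg.
have [ai|ia1] := eqVneq a1 (i : nat); last first.
  rewrite mul0r add0r nth_default ?if_same ?oppr0 // size_h; move/eqP: ia1; lia.
have [aj|ja2] := eqVneq a2 (j : nat); last first.
  rewrite mulr0 add0r nth_default ?if_same ?oppr0 // size_h; move/eqP: ja2; lia.
by rewrite mulr1 -ai -aj ltnNge leq_addr addKn hm subrr.
Qed.

End ProjectiveReedSolomon.

(** * The dimension formula *)

Definition geometric_dim (q e a b : nat) : nat :=
  \sum_(j < a.+1) minn (b - e * j).+1 q.+1.

(** In this form [s_tilde + 1] visibly counts the [j] with [q + e * j <= b]. *)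
Lemma s_tildeE q e b : (0 < e)%N ->
  s_tilde q e b =
    (if (b < q)%N then 0 else ((b - q) %/ e).+1)%N%:Z - 1.
Proof.
move=> e0; rewrite /s_tilde.
have e0Q : (0 : rat) < e%:R by rewrite ltr0n.
have [bq|qb] := ltnP b q.
  have : Num.floor ((b%:R - q%:R) / e%:R : rat) < 0.
    by rewrite floor_lt_int mulr0z pmulr_llt0 ?invr_gt0 // subr_lt0 ltr_nat.
  by move: (Num.floor _) => z; lia.
have -> : Num.floor ((b%:R - q%:R) / e%:R : rat) = ((b - q) %/ e)%N%:Z.
  apply: floor_def; rewrite -natrB // ler_pdivlMr // ltr_pdivrMr //.
  rewrite -[_ + 1]/(_%:Z + 1%:Z) -PoszD -!pmulrn -!natrM ler_nat ltr_nat.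
  by rewrite leq_divM addn1 ltn_ceil.
rewrite max_r; last by apply: (@le_trans _ _ 0).
by rewrite -addn1 PoszD addrK.
Qed.

(** The first [t = s_tilde + 1] summands are capped at [q.+1]; the others form an arithmetic
    progression. *)
Lemma k_dimE q e a b : (0 < e)%N -> (e * a <= b)%N -> (b - e * a < q)%N ->
  k_dim q e a b = (geometric_dim q e a b)%:R.
Proof.
move=> e0 eab beaq; rewrite /k_dim /= s_tildeE //.
set t := (if _ then _ else _)%N.
have [ta tlo thi] : [/\ (t <= a)%N, forall j, (j < t -> q + e * j <= b)%N
    & forall j, (t <= j -> b < q + e * j)%N].
  rewrite /t; case: ltnP => [bq|qb]; first by split=> // j; nia.
  have := divn_eq (b - q) e; have := ltn_pmod (b - q) e0.
  set d := (_ %/ _)%N; set r := (_ %% _)%N => re deq.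
  by split=> [|j|j]; nia.
clearbody t.
have low : \sum_(0 <= j < t) minn (b - e * j).+1 q.+1 = (t * q.+1)%N.
  rewrite -[in RHS](subn0 t) -sum_nat_const_nat; apply: eq_big_nat => j /andP[_ /tlo]; lia.
have high n : (t <= n <= a.+1)%N ->
    (\sum_(t <= j < n) minn (b - e * j).+1 q.+1)%:R =
    (n%:R - t%:R) * (b%:R + 1 - e%:R * ((n%:R + t%:R - 1) / 2)) :> rat.
  elim: n => [|n IHn] /andP[tn na].
    have t0 : t = 0%N by lia.
    by rewrite t0 big_geq // subrr mul0r.
  move: tn; rewrite leq_eqVlt => /predU1P[<-|tn].
    by rewrite big_geq // subrr mul0r.
  rewrite big_nat_recr //= natrD IHn; last by lia.
  have -> : minn (b - e * n).+1 q.+1 = (b - e * n).+1.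
    by have := thi n; lia.
  (* Hence the truncated subtraction [b - e * n] is a true one. *)
  have en : (e * n <= b)%N by apply: leq_trans eab; rewrite leq_mul2l -ltnS na orbT.
  rewrite -[(b - _).+1]addn1 natrD natrB // natrM -[n.+1]addn1 natrD.
  by field.
rewrite /geometric_dim -(big_mkord predT (fun j => minn (b - e * j).+1 q.+1)).
rewrite (@big_cat_nat _ _ _ t) //=; last by lia.
rewrite natrD low high ?leqnn ?andbT; last by lia.
rewrite natrM -addn1 -[a.+1]addn1 !natrD rmorphB /= -pmulrn.
by field.
Qed.

(** The lower bound accommodates the tensor generators; the upper one leaves room for [k1 + k2]
    below the length. *)
Lemma geometric_dim_bounds q e a b :
  (e * a <= b)%N -> (b - e * a < q)%N ->
  (a.+1 * (b - e * a).+1 <= geometric_dim q e a b <= a.+1 * q.+1)%N.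
Proof.
move=> eab beaq; have sum_cst k : (a.+1 * k)%N = \sum_(j < a.+1) k.
  by rewrite sum_nat_const card_ord.
rewrite /geometric_dim 2!sum_cst.
apply/andP; split; apply: leq_sum => j _; last exact: geq_minr.
have := ltn_ord j; nia.
Qed.

(** * Duality of linear codes and the CSS construction *)

Section Codes.
Variables (F : finFieldType) (n : nat).
Implicit Types (s : seq 'rV[F]_n) (u v : 'rV[F]_n) (C : {vspace 'rV[F]_n}).

Definition dotv u v : F := \sum_(i < n) u 0 i * v 0 i.

Lemma dotvC u v : dotv u v = dotv v u.
Proof. by apply: eq_bigr => i _; rewrite mulrC. Qed.

Lemma dual_codeP C v :
  reflect (forall u, u \in C -> dotv u v = 0) (v \in dual_code C).
Proof.
rewrite inE; apply: (iffP forall_inP) => H u uC; first exact/eqP/H.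
exact/eqP/H.
Qed.

(** [W] is the kernel of a map into a space of dimension [size s], so rank-nullity bounds its
    dimension. *)
Lemma exists_orthogonal_space s : exists W : {vspace 'rV[F]_n},
  (forall v, v \in W <-> {in s, forall u, dotv u v = 0}) /\
  (n - size s <= \dim W)%N.
Proof.
pose A := \matrix_(i < n, k < size s) s`_k 0 i.
have AE v k : (v *m A) 0 k = dotv s`_k v.
  by rewrite dotvC !mxE; apply: eq_bigr => i _; rewrite !mxE.
exists (lker (linfun (mulmxr A))); split=> [v|].
  rewrite memv_ker lfunE /=; split=> [/eqP vA u us|orth].
    have us' : (index u s < size s)%N by rewrite index_mem.
    by have := AE v (Ordinal us'); rewrite vA mxE /= nth_index.
  by apply/eqP/rowP => k; rewrite AE mxE orth // mem_nth.
have := limg_ker_dim (linfun (mulmxr A : 'rV_n -> _)) fullv.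
rewrite capfv dimvf /dim /= mul1n => dimE.
have := dimvS (subvf (linfun (mulmxr A : 'rV_n -> _) @: fullv)%VS).
rewrite dimvf /dim /= mul1n => limg_le.
by rewrite leq_subLR -[leqLHS]dimE addnC leq_add2r.
Qed.

(** The columns of the cokernel of a basis matrix cut out [C], so one of them detects [v]. *)
Lemma exists_separating_vector C v : v \notin C ->
  exists2 w, {in C, forall u, dotv u w = 0} & dotv v w != 0.
Proof.
pose A := \matrix_(i < \dim C) (vbasis C)`_i.
have dotvE u k : dotv u (col k (cokermx A))^T = (u *m cokermx A) 0 k.
  by rewrite mxE; apply: eq_bigr => i _; rewrite !mxE.
move=> vC; have: v *m cokermx A != 0.
  apply: contraNneq vC => /eqP; rewrite -submxE => /submxP[D ->].
  rewrite mulmx_sum_row memv_suml // => i _; rewrite rowK memvZ //.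
  by rewrite vbasis_mem // mem_nth ?size_tuple.
case/rV0Pn => k vk; exists (col k (cokermx A))^T; last by rewrite dotvE.
move=> u uC; rewrite dotvE.
have -> : u = (\row_i coord (vbasis C) i u) *m A.
  rewrite mulmx_sum_row {1}(coord_vbasis uC).
  by apply: eq_bigr => i _; rewrite rowK mxE.
by rewrite -mulmxA mulmx_coker mulmx0 mxE.
Qed.

Lemma exists_min_weight (E : {set 'rV[F]_n}) (delta : nat) v0 :
  v0 \in E -> {in E, forall v, (delta <= hamming_weight v)%N} ->
  exists2 d, is_min_weight E d & (delta <= d)%N.
Proof.
move=> v0E bound; case: (arg_minnP (@hamming_weight F n) v0E) => v vE vmin.
by exists (hamming_weight v); [split=> //; exists v | apply: bound].
Qed.

(** Since [k1] and [k2] only bound the numbers of generators, no rank has to be computed: [C1] and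
    [C2] are chosen with the required dimensions. *)
Lemma exists_CSS_code s1 s2 k1 k2 delta :
  {in s1 & s2, forall u v, dotv u v = 0} ->
  (size s1 <= k1)%N -> (size s2 <= k2)%N -> (k1 + k2 < n)%N ->
  (forall v, v != 0 -> {in s1, forall u, dotv u v = 0} ->
    (delta <= hamming_weight v)%N) ->
  (forall v, v != 0 -> {in s2, forall u, dotv u v = 0} ->
    (delta <= hamming_weight v)%N) ->
  exists C1 C2 d, is_CSS_code C1 C2 (n - k2 - k1) d /\ (delta <= d)%N.
Proof.
move=> orth size1 size2 kn weight1 weight2.
have [W [inW dimW]] := exists_orthogonal_space s2.
have s1W : (<<s1>> <= W)%VS.
  by apply/span_subvP => u us1; apply/inW => v vs2; rewrite dotvC orth.
have [C1 [s1C1 C1W dim1]] : exists C1, [/\ (<<s1>> <= C1)%VS, (C1 <= W)%VS & \dim C1 = k1].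
  apply: exists_subspace_dim s1W _; rewrite (leq_trans (dim_span s1) size1).
  by rewrite (leq_trans _ dimW) //; lia.
have [C2 [C12 C2W dim2]] : exists C2, [/\ (C1 <= C2)%VS, (C2 <= W)%VS & \dim C2 = (n - k2)%N].
  apply: exists_subspace_dim C1W _; rewrite dim1 (leq_trans _ dimW) ?andbT; lia.
(* [x] and then [w] show that the two differences of codes are nonempty, as minimal weights
   require. *)
have [x xC2 xC1] : exists2 x, x \in C2 & x \notin C1.
  apply/subvPn/negP => /dimvS; rewrite dim1 dim2; lia.
have [w wC1 wx] := exists_separating_vector xC1.
have [|v|d1 d1min d1le] := @exists_min_weight (vectors C2 :\: vectors C1) delta x.
- by rewrite !inE xC1.
- rewrite !inE => /andP[vC1 vC2]; apply: weight2; last exact/inW/(subvP C2W).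
  by apply: contraNneq vC1 => ->; rewrite mem0v.
have [|v|d2 d2min d2le] := @exists_min_weight (dual_code C1 :\: dual_code C2) delta w.
- rewrite inE; apply/andP; split; last exact/dual_codeP.
  by apply/negP => /dual_codeP/(_ x xC2)/eqP; apply/negP.
- rewrite inE => /andP[vC2 /dual_codeP vC1]; apply: weight1.
    apply: contraNneq vC2 => ->; apply/dual_codeP => u _.
    by rewrite /dotv big1 // => i _; rewrite mxE mulr0.
  by move=> u us1; apply: vC1; apply: (subvP s1C1); apply: memv_span.
exists C1, C2, (minn d1 d2); split; last by rewrite leq_min d1le d2le.
split=> //; first by rewrite dim1 dim2.
by exists d1, d2.
Qed.

(** * Tensor products of evaluation codes, with coordinates indexed through [phi] *)

Section Tensor.
Variables (P Q : finType) (phi : 'I_n -> P * Q) (psi : P * Q -> 'I_n).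
Hypotheses (phiK : cancel phi psi) (psiK : cancel psi phi).

Definition tensor (f : P -> F) (g : Q -> F) : 'rV[F]_n :=
  \row_i (f (phi i).1 * g (phi i).2).

Definition tensors m l (f : 'I_m -> P -> F) (g : 'I_l -> Q -> F) :=
  [seq tensor (f z.1) (g z.2) | z : 'I_m * 'I_l].

Lemma size_tensors m l (f : 'I_m -> P -> F) (g : 'I_l -> Q -> F) :
  size (tensors f g) = (m * l)%N.
Proof. by rewrite size_image card_prod !card_ord. Qed.

Lemma dotv_tensor f1 g1 f2 g2 : dotv (tensor f1 g1) (tensor f2 g2) =
  (\sum_x f1 x * f2 x) * (\sum_y g1 y * g2 y).
Proof.
rewrite big_distrlr pair_big /= (reindex phi) /=; last by exists psi => ? _.
by apply: eq_bigr => i _; rewrite !mxE mulrACA.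
Qed.

Lemma tensors_dual_weight m l (f : 'I_m -> P -> F) (g : 'I_l -> Q -> F) a b v :
  separates f a -> separates g b -> v != 0 ->
  {in tensors f g, forall u, dotv u v = 0} ->
  (minn a b + 2 <= hamming_weight v)%N.
Proof.
move=> sepf sepg /rV0Pn[i vi] orth.
have -> : hamming_weight v = #|[set z | v 0 (psi z) != 0]|.
  rewrite -(card_imset _ (can_inj psiK)) /hamming_weight; apply: eq_card => j.
  rewrite inE; apply/idP/imsetP => [vj|[z]]; last by rewrite inE => ? ->.
  by exists (phi j); rewrite ?inE phiK.
apply: (tensor_orth_weight sepf sepg); last by exists (phi i); rewrite phiK.
move=> j k; rewrite (reindex phi) /=; last by exists psi => ? _.
rewrite -[RHS](orth (tensor (f j) (g k))).
  by apply: eq_bigr => r _; rewrite mxE phiK.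
by apply/imageP; exists (j, k).
Qed.

End Tensor.
End Codes.

Theorem theorem6p6 (q : nat) (F : finFieldType) (hF : #|F| = q)
    (e : nat) (he : (2 <= e)%N)
    (a1 b1 a2 b2 : nat)
    (ha1 : a1%:Z <= q%:Z - 2)
    (hb1 : 0 <= b1%:Z - e%:Z * a1%:Z <= q%:Z - 1)
    (ha2 : a1%:Z <= q%:Z - a2%:Z - 3)
    (hb2 : 0 <= b2%:Z - e%:Z * a2%:Z <= q%:Z - 1) :
  exists (C1 C2 : {vspace 'rV[F]_((q + 1) ^ 2)}) (k d : nat),
    [/\ is_CSS_code C1 C2 k d,
        k%:R = ((q + 1) ^ 2)%:R - k_dim q e a2 b2 - k_dim q e a1 b1 :> rat &
        Num.min (Num.min a1%:Z a2%:Z)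
                (Num.min (b1%:Z - e%:Z * a1%:Z) (b2%:Z - e%:Z * a2%:Z)) + 2
          <= d%:Z].
Proof.
have e0 : (0 < e)%N by lia.
have a12 : (a1 + a2 + 3 <= q)%N by lia.
have eab1 : (e * a1 <= b1)%N by lia.
have eab2 : (e * a2 <= b2)%N by lia.
have beaq1 : (b1 - e * a1 < q)%N by lia.
have beaq2 : (b2 - e * a2 < q)%N by lia.
rewrite !k_dimE //.
have /andP[lo1 hi1] := geometric_dim_bounds eab1 beaq1.
have /andP[lo2 hi2] := geometric_dim_bounds eab2 beaq2.
move: (geometric_dim q e a1 b1) (geometric_dim q e a2 b2) lo1 hi1 lo2 hi2.
move=> k1 k2 lo1 hi1 lo2 hi2.
(* The sum is at most [(a1 + a2 + 2) * (q + 1)], hence at most [(q - 1) * (q + 1)]. *)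
have kn : (k1 + k2 < (q + 1) ^ 2)%N by nia.
have [|h [h_monic size_h h0]] := @exists_monic_rootless F (q.-1 - (a1 + a2)); first by lia.
set m := (q.-1 - _)%N in size_h.
have card_pts : #|{: option F * option F}| = ((q + 1) ^ 2)%N.
  by rewrite card_prod card_option hF addn1 mulnn.
pose phi (i : 'I_((q + 1) ^ 2)) := enum_val (cast_ord (esym card_pts) i).
pose psi z := cast_ord card_pts (enum_rank z).
have phiK : cancel phi psi by move=> i; rewrite /psi enum_valK cast_ordKV.
have psiK : cancel psi phi by move=> z; rewrite /phi cast_ordK enum_rankK.
pose V1 := @proj_mono F a1.
pose V2 := fun j x => proj_eval m h x * @proj_mono F a2 j x.
pose W1 := @proj_mono F (b1 - e * a1).
pose W2 := @proj_mono F (b2 - e * a2).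
have sepV1 : separates V1 a1 by exact: separates_proj_mono.
have sepV2 : separates V2 a2.
  apply: separates_scale; last exact: separates_proj_mono.
  (* At infinity [h] takes the value of its leading coefficient, 1. *)
  case=> [t|] //=; move/monicP: h_monic; rewrite lead_coefE size_h /= => ->.
  exact: oner_neq0.
have sepW1 : separates W1 (b1 - e * a1) by exact: separates_proj_mono.
have sepW2 : separates W2 (b2 - e * a2) by exact: separates_proj_mono.
pose delta := (minn (minn a1 a2) (minn (b1 - e * a1) (b2 - e * a2)) + 2)%N.
have := @exists_CSS_code F _ (tensors phi V1 W1) (tensors phi V2 W2) k1 k2 delta.
case=> [||||v v0 orth|v v0 orth|C1 [C2 [d [css dle]]]].
- move=> u v /imageP[z _ ->] /imageP[z' _ ->].
  (* The inner product factors, so orthogonality of [V1] and [V2] suffices. *)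
  rewrite (dotv_tensor phiK psiK) (@proj_mono_orth F a1 a2 m) ?mul0r //.
  by rewrite hF /m; lia.
- by rewrite size_tensors.
- by rewrite size_tensors.
- exact: kn.
- have := tensors_dual_weight phiK psiK sepV1 sepW1 v0 orth.
  by rewrite /delta; lia.
- have := tensors_dual_weight phiK psiK sepV2 sepW2 v0 orth.
  by rewrite /delta; lia.
exists C1, C2, ((q + 1) ^ 2 - k2 - k1)%N, d; split=> //.
  by rewrite !natrB //; lia.
by move: dle; rewrite /delta; lia.
Qed.
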